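(* Let $X$ be a real Banach space with single-valued normalized duality mapping, let $N\ge1$, let $F_1,\dots,F_N:X\to X$ be accretive operators and $f_1,\dots,f_N\in X$ such that the system $F_i(x)=f_i$, $i=1,\dots,N$, possesses an exact solution $\widehat{x}^*$. Assume that the $F_i$ are Fréchet differentiable in the closed ball $B_r(\widehat{x}^* )\subset X$ with center $\widehat{x}^*$ and radius $r>0$, and that for some constant $K$ $$\|F_i'(x)-F_i'(y)\|\le K\|x-y\|\quad\text{for all }x,y\in B_r(\widehat{x}^* ),\ i=1,\dots,N.$$ Let $\{\alpha_n\}_{n\ge0}$ be a sequence of real numbers with $\alpha_n>0$, $\alpha_n\to0$ and $1\le\frac{\alpha_n}{\alpha_{n+1}}\le\rho$ for all $n$, where $\rho>1$ is a constant. Assume that the points $x_i^0\in B_r(\widehat{x}^* )$ satisfy $$x_i^0-\widehat{x}^*=F_i'(\widehat{x}^* )v_i,\qquad v_i\in X,\quad i=1,\dots,N.$$ For noise levels $\delta,h>0$ let $f_i^\delta\in X$ and let $F_i^h:X\to X$ be accretive operators, Fréchet differentiable in $B_r(\widehat{x}^* )$, such that for $i=1,\dots,N$ $$\|f_i^\delta-f_i\|\le\delta,\qquad \|F_i^{h\prime}(x)-F_i^{h\prime}(y)\|\le K\|x-y\|\ \ \text{for all }x,y\in B_r(\widehat{x}^* ),$$ $$\|F_i^h(\widehat{x}^* )-F_i(\widehat{x}^* )\|\le h,\qquad \|F_i^{h\prime}(\widehat{x}^* )-F_i'(\widehat{x}^* )\|\le h.$$ Given $x_0\in B_r(\widehat{x}^*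 )$, define $\{x_n\}$ for $n=0,1,2,\dots$ by $$F_i^h(x_n)-f_i^\delta+\frac{\alpha_n}{N}(x_n-x_i^0)+\Big(F_i^{h\prime}(x_n)+\frac{\alpha_n}{N}I\Big)(x_n^i-x_n)=0,\quad i=1,\dots,N,\qquad x_{n+1}=\frac1N\sum_{i=1}^N x_n^i,$$ and define $$N(\delta,h)=\max\Big\{n:\alpha_n^2\ge\frac{\delta+h}{\eta}\Big\},\qquad n_*=N(\delta,h)+1,$$ where $\eta>0$ is a fixed parameter. If $\sum_{i=1}^N\|v_i\|$ is sufficiently small and $x_0$ is close enough to $\widehat{x}^*$, then $$\|x_{n_*}-\widehat{x}^*\|=O\big(\delta^{1/2}+h^{1/2}\big).$$
   Context: The normalized duality mapping $J:X\to X^*$ satisfies $\langle x,J(x)\rangle=\|x\|^2=\|J(x)\|^2$ for all $x\in X$; it is assumed single valued. An operator $A:X\to X$ is accretive if $\langle A(x)-A(y),J(x-y)\rangle\ge 0$ for all $x,y\in X$. $I$ is the identity operator. $F_i'$ and $F_i^{h\prime}$ denote the Fréchet derivatives of $F_i$ and $F_i^h$. The noise levels are such that $\alpha_0^2\ge(\delta+h)/\eta$, so that $N(\delta,h)$ is defined. $O(\delta^{1/2}+h^{1/2})$ means bounded by $C(\delta^{1/2}+h^{1/2})$ with a constant $C$ independent of $\delta$ and $h$ ($\eta$ being fixed).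
   Formalization: The parameter η is required to be sufficiently small (0 < η ≤ η₀, with η₀ depending on the exact problem, r, K, ρ and the sequence α_n); for arbitrary fixed η > 0 the claim is false, since the iteration may diverge even with v_i = 0 and x_0 equal to the exact solution. *)

(* Defs.v *)
From HB Require Import structures.
From mathcomp Require Export all_boot all_order all_algebra.
From mathcomp Require Export all_classical all_reals all_analysis.
Export Order.TTheory GRing.Theory Num.Theory.
Export numFieldNormedType.Exports.

Set Implicit Arguments.
Unset Strict Implicit.
Unset Printing Implicit Defensive.

#[global] Open Scope classical_set_scope.
#[global] Open Scope ring_scope.

(* [sup] is the real supremum, so this is the operator norm only for
   continuous linear [A]; it is [0] when the set is unbounded. *)
Definition opnorm (R : realType) (V W : normedModType R) (A : V -> W) : R :=
  sup [set `|A u| | u in [set u : V | `|u| <= 1]].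

(* The dual space is the set of continuous [g : {linear X -> R^o}], normed by
   [opnorm]; this says [g \in J(x)] for the set-valued normalized duality
   mapping [J]. *)
Definition in_duality (R : realType) (X : normedModType R) (x : X)
    (g : {linear X -> R^o}) : Prop :=
  [/\ continuous g, g x = `|x| ^+ 2 & opnorm g ^+ 2 = `|x| ^+ 2].

Definition single_valued_duality_map (R : realType) (X : normedModType R)
    (J : X -> {linear X -> R^o}) : Prop :=
  forall (x : X) (g : {linear X -> R^o}), in_duality x g <-> g =1 J x.

Definition accretive (R : realType) (X : normedModType R)
    (J : X -> {linear X -> R^o}) (A : X -> X) : Prop :=
  forall x y : X, 0 <= J (x - y) (A x - A y) :> R.

Definition frechet_on (R : realType) (X : normedModType R) (B : set X)
    (A : X -> X) : Prop :=
  forall x : X, B x -> differentiable A x.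

Definition lipschitz_derivative_on (R : realType) (X : normedModType R)
    (B : set X) (K : R) (A : X -> X) : Prop :=
  forall x y : X, B x -> B y ->
    opnorm ('d A x \- 'd A y : X -> X) <= K * `|x - y|.

(* Meaningful when the maximum exists, e.g. when [alpha] is nonincreasing,
   tends to [0] and [(delta + h) / eta <= alpha 0 ^+ 2] with [delta + h] and
   [eta] positive. *)
Definition stop_index (R : realType) (alpha : nat -> R) (eta delta h : R) : nat :=
  get [set n : nat | (delta + h) / eta <= alpha n ^+ 2 /\
    forall k : nat, (delta + h) / eta <= alpha k ^+ 2 -> (k <= n)%N].

(* One step [n] of the parallel method: [x = x_n], [x' = x_{n+1}] and
   [xi i = x_n^i]; [A i] and [b i] are the perturbed operators and data. *)
Definition parallel_step (R : realType) (X : normedModType R) (N : nat)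
    (A : 'I_N -> X -> X) (b x0 : 'I_N -> X) (a : R)
    (x : X) (xi : 'I_N -> X) (x' : X) : Prop :=
  (forall i : 'I_N,
     A i x - b i + (a / N%:R) *: (x - x0 i)
     + ('d (A i) x (xi i - x) + (a / N%:R) *: (xi i - x)) = 0) /\
  x' = N%:R^-1 *: \sum_(i < N) xi i.

(* Main.v *)
Require Import Defs.
From mathcomp Require Import lra ring.

Set Implicit Arguments.
Unset Strict Implicit.
Unset Printing Implicit Defensive.

(** Write [e_n] for [`|x_n - xs|], [S] for the sum of the [`|v i|] and [d] for
    [delta + h].  The theorem follows from the bound [e_n <= g * alpha_n] for
    all [n <= n_*], where [g] does not depend on the noise: the stopping rule
    gives [alpha_m ^+ 2 < d / eta] at [m = n_*], so the error there is less than
    [g * sqrt (d / eta)], which is at most [C * (sqrt delta + sqrt h)].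

    The bound on [e_n] is proved by induction.  One step of the method
    satisfies (lemma [parallel_step_le])
      [e_(n+1) <= N (K e_n^2 + d) / alpha_n + S (K e_n + d + 2 alpha_n)].
    As long as the iteration has not stopped, [d <= eta * alpha_n ^+ 2]; then
    [e_n <= g * alpha_n] makes the right-hand side at most [alpha_n] times
      [N (K g^2 + eta) + S (K g + eta alpha_0 + 2)],
    and since [alpha_n <= rho * alpha_(n+1)] the induction closes when [rho]
    times this factor is at most [g] (lemma [step_gain_le]).  Its share in
    [g^2] is made at most [g / 4] by the choice of [g], the share in [N eta] by
    the choice of [eta0], and the share in [S] at most [g / 2] by the bound on
    [S].  The induction starts because [x0] is taken within [g * alpha_0] of
    [xs], and [g * alpha_0 <= r] keeps every iterate in the ball.

    The one-step estimate has three ingredients, all obtained from the duality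
    mapping [J].
    - The functional [J w] norms [w]: [J w w = `|w| ^+ 2] and
      [`|J w u| <= `|w| * `|u|].  It reduces the mean value inequality for
      maps into [X], hence the quadratic Taylor estimate, to the scalar mean
      value theorem ([mean_value_le], [taylor_le]).
    - The derivative of an accretive operator is accretive
      ([accretive_diff]): divide the accretivity inequality between [x + h u]
      and [x] by [h^2] and let [h] tend to [0].
    - If [T] is accretive, then [a * `|w| <= `|T w + a *: w|]
      ([resolvent_le]): apply [J w] to [T w + a *: w].
    The source condition [xi0 - xs = F'(xs) v] enters through the vector
    [w = x_n^i - xs - a *: v] (lemma [newton_step_le]): in the equation for
    [w] the term [a *: (xi0 - xs)], which is of order [a], cancels up to
    perturbations and leaves [- a ^+ 2 *: v].  No inverse of
    [T + a I] is ever formed, since the iterates are given as solutions. *)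

(** * Operator norm *)

Lemma opnorm_set_nonempty (R : realType) (V W : normedModType R) (A : V -> W) :
  [set `|A u| | u in [set u : V | `|u| <= 1]] !=set0.
Proof. by exists `|A 0|; exists 0 => //=; rewrite normr0 ler01. Qed.

Lemma le_opnorm (R : realType) (V W : normedModType R) (g : {linear V -> W})
    (u : V) : continuous g -> `|g u| <= opnorm g * `|u|.
Proof.
move=> /linear_bounded_continuous/linear_boundedP/pinfty_ex_gt0[M M0 gM].
have [->|u0] := eqVneq u 0; first by rewrite raddf0 !normr0 mulr0.
have nu0 : 0 < `|u| by rewrite normr_gt0.
have : `|g (`|u|^-1 *: u)| <= opnorm g.
  apply: ub_le_sup.
    exists M => _ [z /= z1 <-]; apply: (le_trans (gM z)).
    by rewrite -[leRHS]mulr1 ler_wpM2l// ltW.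
  exists (`|u|^-1 *: u) => //=.
  by rewrite normrZ ger0_norm ?invr_ge0// mulVf ?normr_eq0.
by rewrite linearZ/= normrZ ger0_norm ?invr_ge0// ler_pdivrMl// mulrC.
Qed.

Lemma opnorm_le (R : realType) (V W : normedModType R) (A : V -> W) (M : R) :
  0 <= M -> (forall u, `|A u| <= M * `|u|) -> opnorm A <= M.
Proof.
move=> M0 AM; apply: ge_sup; first exact: opnorm_set_nonempty.
move=> _ [u /= u1 <-]; apply: (le_trans (AM u)).
by rewrite -[leRHS]mulr1 ler_wpM2l.
Qed.

(** When the set of norms is unbounded its supremum is [0] by convention. *)
Lemma opnorm_ge0 (R : realType) (V W : normedModType R) (A : V -> W) :
  0 <= opnorm A.
Proof.
have [ub|nub] := pselect (has_ubound [set `|A u| | u in [set u : V | `|u| <= 1]]).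
  apply: le_trans (normr_ge0 (A 0)) _; apply: ub_le_sup => //.
  by exists 0 => //=; rewrite normr0 ler01.
by rewrite /opnorm sup_out// => -[].
Qed.

(** * Normalized duality mapping *)

(** Membership in the duality mapping without the supremum in [opnorm]; the
    equality of norms is automatic, since [g x = `|x| ^+ 2] bounds [opnorm g]
    from below by [`|x|]. *)
Lemma in_dualityP (R : realType) (X : normedModType R) (x : X)
    (g : {linear X -> R^o}) :
  in_duality x g <->
  [/\ continuous g, g x = `|x| ^+ 2 & forall u, `|g u| <= `|x| * `|u|].
Proof.
split=> [[gc gx /eqP]|[gc gx gle]].
  rewrite eqrXn2 ?opnorm_ge0// => /eqP gn.
  by split=> // u; rewrite -gn; exact: le_opnorm.
split=> //; congr (_ ^+ 2); apply/eqP; rewrite eq_le opnorm_le//=.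
have [->|x0] := eqVneq x 0; first by rewrite normr0 opnorm_ge0.
have := le_opnorm x gc; rewrite gx ger0_norm ?sqr_ge0// expr2.
by rewrite ler_pM2r// normr_gt0.
Qed.

Lemma duality_continuous (R : realType) (X : normedModType R)
    (J : X -> {linear X -> R^o}) (x : X) :
  single_valued_duality_map J -> continuous (J x).
Proof. by move=> /(_ x (J x))[_ /(_ (fun=> erefl))/in_dualityP[]]. Qed.

Lemma duality_self (R : realType) (X : normedModType R)
    (J : X -> {linear X -> R^o}) (x : X) :
  single_valued_duality_map J -> J x x = `|x| ^+ 2.
Proof. by move=> /(_ x (J x))[_ /(_ (fun=> erefl))/in_dualityP[]]. Qed.

Lemma duality_le (R : realType) (X : normedModType R)
    (J : X -> {linear X -> R^o}) (x u : X) :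
  single_valued_duality_map J -> `|J x u| <= `|x| * `|u|.
Proof. by move=> /(_ x (J x))[_ /(_ (fun=> erefl))/in_dualityP[]]. Qed.

Lemma duality_le_mul (R : realType) (X : normedModType R)
    (J : X -> {linear X -> R^o}) (x u : X) :
  single_valued_duality_map J -> J x u <= `|x| * `|u| :> R.
Proof. by move=> /(duality_le x u); apply: le_trans; exact: ler_norm. Qed.

(** By single-valuedness it is enough that [t \*: J x] is a duality functional
    of [t *: x]. *)
Lemma dualityZ (R : realType) (X : normedModType R)
    (J : X -> {linear X -> R^o}) (t : R) (x u : X) :
  single_valued_duality_map J -> J (t *: x) u = t *: J x u.
Proof.
move=> Jsv; have [/(_ _) + _] := Jsv (t *: x) (t \*: J x).
move=> /(_ _ u)/= <- //; apply/in_dualityP; split=> [v|/=|v /=].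
- by apply: continuousZl_tmp; exact: duality_continuous.
- rewrite linearZ/= duality_self// normrZ exprMn real_normK ?num_real//.
  by rewrite expr2 -mulrA.
- by rewrite normrZ normrZ -mulrA ler_wpM2l//; exact: duality_le.
Qed.

(** * Accretive operators and the mean value inequality *)

(** Accretivity of [A] between [h *: u + x] and [x], divided by [h ^+ 2] thanks
    to the homogeneity of [J], is a bound on the difference quotient of [A] at
    [x] along [u]; it passes to the limit because [J u] is continuous. *)
Lemma accretive_diff (R : realType) (X : normedModType R)
    (J : X -> {linear X -> R^o}) (A : X -> X) (x u : X) :
  single_valued_duality_map J -> accretive J A -> differentiable A x ->
  0 <= J u ('d A x u) :> R.
Proof.
move=> Jsv Aacc dA.
have /cvg_ex[l /= cl] := @diff_derivable _ _ _ _ _ u dA.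
have dl : 'd A x u = l by rewrite -deriveE//; exact: cvg_lim cl.
rewrite dl.
have cJ : J u (h^-1 *: (A (h *: u + x) - A x)) @[h --> 0^'] --> J u l.
  by apply: continuous_cvg cl; exact: duality_continuous.
apply: cvgr_to_ge cJ _.
near=> h.
have h0 : h != 0 by near: h; exact: nbhs_dnbhs_neq.
have := Aacc (h *: u + x) x.
rewrite addrK dualityZ// linearZ/=.
have -> : h^-1 *: J u (A (h *: u + x) - A x) =
  (h ^+ 2)^-1 *: (h *: J u (A (h *: u + x) - A x)).
  by rewrite scalerA expr2 invfM -mulrA mulVf// mulr1.
by move=> ?; rewrite mulr_ge0// invr_ge0 sqr_ge0.
Unshelve. all: by end_near. Qed.

(** For positive [a] this is the bound [1 / a] on the norm of [(T + a I)^-1],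
    in a form that does not presuppose an inverse. *)
Lemma resolvent_le (R : realType) (X : normedModType R)
    (J : X -> {linear X -> R^o}) (T : X -> X) (a : R) (w : X) :
  single_valued_duality_map J -> 0 <= J w (T w) :> R ->
  a * `|w| <= `|T w + a *: w|.
Proof.
move=> Jsv Tw.
have [->|w0] := eqVneq w 0; first by rewrite normr0 mulr0.
rewrite -(@ler_pM2l _ `|w|) ?normr_gt0//.
apply: le_trans (duality_le_mul w (T w + a *: w) Jsv).
rewrite linearD linearZ/= duality_self// [leLHS]mulrCA -expr2.
by rewrite -[leLHS]add0r lerD2r.
Qed.

(** The functional [J w], with [w] the vector to be estimated, plays the part
    of a Hahn-Banach norming functional: the scalar mean value theorem for
    [t |-> J w (A (y + t *: (x - y)))] gives a point [c] of the segment where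
    [`|w| ^+ 2 = J w ('d A c (x - y) - z)]. *)
Lemma mean_value_le (R : realType) (X : normedModType R)
    (J : X -> {linear X -> R^o}) (A : X -> X) (x y z : X) (M : R) :
  single_valued_duality_map J ->
  (forall t : R, 0 <= t <= 1 -> differentiable A (y + t *: (x - y))) ->
  (forall t : R, 0 <= t <= 1 -> `|'d A (y + t *: (x - y)) (x - y) - z| <= M) ->
  `|A x - A y - z| <= M.
Proof.
move=> Jsv Ad Ale; set w := A x - A y - z.
have [->|w0] := eqVneq w 0.
  by rewrite normr0; apply: le_trans (Ale 0 _); rewrite ?lexx ?ler01.
set d := x - y in Ad Ale *.
pose ph (t : R) : R := J w (A (y + t *: d)).
have phd (t : R) : 0 <= t <= 1 -> is_diff t ph (fun s => J w ('d A (y + t *: d) (s *: d))).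
  move=> t01.
  have Jc : continuous (J w) by exact: duality_continuous.
  have dJ p : is_diff p (J w : X -> R^o) (J w).
    by apply: DiffDef; [exact: linear_differentiable|rewrite diff_lin].
  have dA : is_diff (y + t *: d) A ('d A (y + t *: d)).
    by apply: DiffDef => //; exact: Ad.
  have dl : is_diff t (fun s : R => y + s *: d) (fun s => s *: d).
    have -> : (fun s : R => y + s *: d) = cst y + ( *:%R ^~ d) by [].
    by apply: is_diff_eq; rewrite add0r.
  have := is_diff_comp (is_diff_comp dl dA) (dJ _).
  exact.
have [||c c01] := @MVT_segment R ph (fun t => J w ('d A (y + t *: d) d)) 0 1 ler01.
- move=> t /itvP t01; have [|phd1 phdE] := phd t _; first by rewrite !t01.
  apply: DeriveDef; first exact: diff_derivable.
  by rewrite deriveE// phdE scale1r.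
- apply: continuous_in_subspaceT => t /set_mem/= /itvP t01.
  have [|phd1 _] := phd t _; first by rewrite !t01.
  exact: differentiable_continuous.
have yd : y + d = x by rewrite /d addrC subrK.
rewrite subr0 mulr1 /ph scale1r scale0r addr0 yd -linearB => E.
have c01' : 0 <= c <= 1 by rewrite !(itvP c01).
rewrite -(@ler_pM2l _ `|w|) ?normr_gt0// -expr2 -(duality_self w Jsv).
rewrite [in X in X <= _]/w linearB/= E -linearB/=.
apply: (le_trans (duality_le_mul _ _ Jsv)).
by rewrite ler_wpM2l// Ale.
Qed.

Lemma lipschitz_derivative_le (R : realType) (X : normedModType R) (B : set X)
    (K : R) (A : X -> X) (x y u : X) :
  frechet_on B A -> lipschitz_derivative_on B K A -> B x -> B y ->
  `|'d A x u - 'd A y u| <= K * `|x - y| * `|u|.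
Proof.
move=> Ad AK Bx By; apply: le_trans (ler_wpM2r _ (AK _ _ Bx By)) => //.
apply: (@le_opnorm _ _ _ ('d A x \- 'd A y : {linear X -> X})) => p.
by apply: continuousB; apply: diff_continuous; exact: Ad.
Qed.

Lemma closed_ball_segment (R : realType) (X : normedModType R) (xs x : X)
    (r t : R) : 0 < r -> closed_ball xs r x -> 0 <= t <= 1 ->
  closed_ball xs r (xs + t *: (x - xs)).
Proof.
move=> r0; rewrite !closed_ballE//= => Bx /andP[t0 t1].
rewrite /closed_ball_/= opprD addNKr normrN normrZ ger0_norm//.
by apply: le_trans Bx; rewrite distrC ler_piMl.
Qed.

(** Mean value inequality with [z = 'd A x (x - xs)]: the Lipschitz bound on the
    derivative is used with the length of the whole segment, whence [K] instead
    of the sharp [K / 2], which changes only the constants of the final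
    estimate. *)
Lemma taylor_le (R : realType) (X : normedModType R)
    (J : X -> {linear X -> R^o}) (A : X -> X) (xs x : X) (r K : R) :
  single_valued_duality_map J -> 0 < r -> 0 <= K ->
  frechet_on (closed_ball xs r) A ->
  lipschitz_derivative_on (closed_ball xs r) K A -> closed_ball xs r x ->
  `|A x - A xs - 'd A x (x - xs)| <= K * `|x - xs| ^+ 2.
Proof.
move=> Jsv r0 K0 Ad AK Bx.
apply: (mean_value_le Jsv) => t t01; have Bt := closed_ball_segment r0 Bx t01.
  exact: Ad.
apply: le_trans (lipschitz_derivative_le _ Ad AK Bt Bx) _.
rewrite expr2 mulrA ler_wpM2r// ler_wpM2l//.
have -> : xs + t *: (x - xs) - x = (t - 1) *: (x - xs).
  by rewrite scalerBl scale1r opprB addrAC addrC addrA.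
rewrite normrZ ler_piMl// distrC ger0_norm; lra.
Qed.

(** * One step of the method *)

(** The shift by [a *: v] uses the source condition without inverting
    [T + a I], with [T = 'd A x]: as [a *: T v = (T + a I) (a *: v) - a ^+ 2 *: v],
    the right-hand side of the equation for [w] contains only the Taylor
    remainder, the data error, the error in the source condition, the
    variation of the derivative and [a ^+ 2 *: v], which all stay small after
    division by [a]. *)
Lemma newton_step_le (R : realType) (X : normedModType R)
    (J : X -> {linear X -> R^o}) (A : X -> X) (xs x x' x0 b v : X)
    (r K a d h : R) :
  single_valued_duality_map J -> accretive J A -> 0 < r -> 0 <= K ->
  frechet_on (closed_ball xs r) A ->
  lipschitz_derivative_on (closed_ball xs r) K A -> closed_ball xs r x ->
  0 < a -> `|b - A xs| <= d -> `|x0 - xs - 'd A xs v| <= h ->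
  A x - b + a *: (x - x0) + ('d A x (x' - x) + a *: (x' - x)) = 0 ->
  `|x' - xs| <= (K * `|x - xs| ^+ 2 + d) / a
     + (K * `|x - xs| * `|v| + h + 2 * a * `|v|).
Proof.
move=> Jsv Aacc r0 K0 Ad AK Bx a0 bd xh E.
have Bs : closed_ball xs r xs by rewrite closed_ballE//= /closed_ball_/= subrr normr0 ltW.
set T := 'd A x in E *.
pose w := x' - xs - a *: v.
have Ew : T w + a *: w = - (A x - A xs - T (x - xs)) + (b - A xs)
   + a *: ((x0 - xs - 'd A xs v) - (T v - 'd A xs v) - a *: v).
  have Ed : T (x' - x) + a *: (x' - x) = - (A x - b) - a *: (x - x0).
    by apply/eqP; rewrite -opprD -addr_eq0 addrC E.
  have -> : w = (x' - x) + (x - xs) - a *: v by rewrite subrKA.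
  rewrite linearB linearD scalerBr scalerDr linearZ/= addrACA -opprD addrACA Ed.
  have -> : - (A x - A xs - T (x - xs)) + (b - A xs) = - (A x - b) + T (x - xs).
    by rewrite !opprB -addrA [A xs - A x + _]addrC subrKA addrC.
  rewrite addrACA -addrA; congr (_ + _).
  rewrite [- (a *: (x - x0)) + _]addrC -scalerBr -scalerDr -scalerBr; congr (_ *: _).
  have -> : x0 - xs - 'd A xs v - (T v - 'd A xs v) = x0 - xs - T v.
    by rewrite opprB subrKA.
  by rewrite [- (x - x0)]opprB [x - xs + _]addrC subrKA opprD addrA.
have := resolvent_le a Jsv (accretive_diff w Jsv Aacc (Ad _ Bx)).
rewrite -/T Ew => aw.
have e2 : `|- (A x - A xs - T (x - xs))| <= K * `|x - xs| ^+ 2.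
  by rewrite normrN; exact: (taylor_le Jsv r0 K0 Ad AK Bx).
have e3 : `|T v - 'd A xs v| <= K * `|x - xs| * `|v|.
  exact: lipschitz_derivative_le AK Bx Bs.
have {}aw : a * `|w| <= K * `|x - xs| ^+ 2 + d
    + a * (h + K * `|x - xs| * `|v| + a * `|v|).
  apply: le_trans aw _; apply: le_trans (ler_normD _ _) _.
  apply: lerD; first by apply: le_trans (ler_normD _ _) _; exact: lerD.
  rewrite normrZ gtr0_norm// ler_pM2l//.
  apply: le_trans (ler_normB _ _) _; rewrite normrZ gtr0_norm// lerD2r.
  by apply: le_trans (ler_normB _ _) _; exact: lerD.
have -> : x' - xs = w + a *: v by rewrite subrK.
apply: le_trans (ler_normD _ _) _; rewrite normrZ gtr0_norm//.
rewrite -(ler_pM2l a0) mulrDr [leRHS]mulrDr [a * (_ / a)]mulrC divfK ?gt_eqF//.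
lra.
Qed.

Lemma normr_mean_le (R : realType) (X : normedModType R) (N : nat)
    (u : 'I_N -> X) (c : X) (M : R) : (1 <= N)%N ->
  (forall i, `|u i - c| <= M) -> `|N%:R^-1 *: (\sum_(i < N) u i) - c| <= M.
Proof.
move=> N1 uM; have N0 : 0 < N%:R :> R by rewrite ltr0n.
have -> : N%:R^-1 *: (\sum_(i < N) u i) - c = N%:R^-1 *: \sum_(i < N) (u i - c).
  rewrite sumrB scalerBr sumr_const card_ord -[c *+ N]scaler_nat scalerA.
  by rewrite mulVf ?gt_eqF// scale1r.
rewrite normrZ ger0_norm ?invr_ge0 ?ler0n// ler_pdivrMl//.
apply: le_trans (ler_norm_sum _ _ _) _; apply: le_trans (ler_sum _ (fun i _ => uM i)) _.
by rewrite sumr_const card_ord mulr_natl.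
Qed.

(** Each component is a step with parameter [a / N]; this is where the factor
    [N] comes from.  One number [d] stands for both the error in the data and
    that in the derivative at [xs], because the stopping rule controls only
    [delta + h]. *)
Lemma parallel_step_le (R : realType) (X : normedModType R)
    (J : X -> {linear X -> R^o}) (N : nat) (A : 'I_N -> X -> X)
    (b x0 v xi : 'I_N -> X) (xs x x' : X) (r K a d S : R) :
  single_valued_duality_map J -> (1 <= N)%N -> (forall i, accretive J (A i)) ->
  0 < r -> 0 <= K -> (forall i, frechet_on (closed_ball xs r) (A i)) ->
  (forall i, lipschitz_derivative_on (closed_ball xs r) K (A i)) ->
  closed_ball xs r x -> 0 < a -> 0 <= d ->
  (forall i, `|b i - A i xs| <= d) ->
  (forall i, `|x0 i - xs - 'd (A i) xs (v i)| <= d * `|v i|) ->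
  (forall i, `|v i| <= S) ->
  parallel_step A b x0 a x xi x' ->
  `|x' - xs| <= N%:R * (K * `|x - xs| ^+ 2 + d) / a
     + S * (K * `|x - xs| + d + 2 * a).
Proof.
move=> Jsv N1 Aacc r0 K0 Ad AK Bx a0 d0 bd xh vS [E ->].
apply: normr_mean_le => // i.
have N0 : 0 < N%:R :> R by rewrite ltr0n.
have aN0 : 0 < a / N%:R by rewrite divr_gt0.
have := newton_step_le Jsv (Aacc i) r0 K0 (Ad i) (AK i) Bx aN0 (bd i) (xh i) (E i).
move/le_trans; apply; apply: lerD.
  by rewrite invfM invrK [a^-1 * _]mulrC mulrA [_ * N%:R]mulrC.
have aN : a / N%:R <= a by rewrite ler_pdivrMr// ler_peMr ?ler1n// ltW.
have -> : K * `|x - xs| * `|v i| + d * `|v i| + 2 * (a / N%:R) * `|v i|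
  = `|v i| * (K * `|x - xs| + d + 2 * (a / N%:R)) by ring.
have Ke : 0 <= K * `|x - xs| by rewrite mulr_ge0.
apply: ler_pM => //; first by rewrite !addr_ge0// mulr_ge0// ltW.
by rewrite lerD2l ler_pM2l.
Qed.

(** * Stopping index and error recursion *)

(** The maximum in the stopping rule exists because [alpha] tends to [0] and
    the rule accepts the index [0]; monotonicity makes the accepted indices an
    initial segment. *)
Lemma stop_indexP (R : realType) (alpha : nat -> R) (eta delta h : R) :
  (forall n, 0 < alpha n) -> {homo alpha : m n / (m <= n)%N >-> n <= m} ->
  alpha @ \oo --> (0 : R) -> 0 < (delta + h) / eta ->
  (delta + h) / eta <= alpha 0%N ^+ 2 ->
  (forall n, (n <= stop_index alpha eta delta h)%N ->
     (delta + h) / eta <= alpha n ^+ 2) /\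
  alpha (stop_index alpha eta delta h).+1 ^+ 2 < (delta + h) / eta.
Proof.
move=> a0 adec acvg; set c := _ / _ => c0 c_le.
have [n0 n0P] : exists n, alpha n ^+ 2 < c.
  have a2 : alpha n * alpha n @[n --> \oo] --> (0 * 0 : R) by exact: cvgM.
  have [|n _ nP] := (cvgr_lt _ a2) c _; first by rewrite mulr0.
  by exists n; rewrite expr2; exact: nP (leqnn n).
have bnd n : c <= alpha n ^+ 2 -> (n <= n0)%N.
  move=> cn; rewrite leqNgt; apply/negP => /ltnW /adec n0n.
  have := lt_le_trans n0P cn; rewrite ltNge; apply/negP; rewrite negbK.
  by rewrite ler_pXn2r// nnegrE ltW.
have [m cm mmax] := ex_maxnP (ex_intro _ 0%N c_le) bnd.
have [] : [set n : nat | c <= alpha n ^+ 2 /\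
    forall k : nat, c <= alpha k ^+ 2 -> (k <= n)%N] (stop_index alpha eta delta h).
  by apply: getPex; exists m; split.
set s := stop_index _ _ _ _ => cs smax; split=> [n ns|].
  apply: le_trans cs _; rewrite ler_pXn2r ?nnegrE ?(ltW (a0 _))//; exact: adec.
by rewrite ltNge; apply/negP => /smax; rewrite ltnn.
Qed.

(** The recursion preserves [e <= g * a]: under the noise level
    [d <= eta * a ^+ 2] every term of the step estimate is at most [a] times its
    counterpart in the last hypothesis, and [a <= rho * a']. *)
Lemma step_gain_le (R : realType) (n K g eta S a0 a a' rho e d : R) :
  0 < rho -> 0 < n -> 0 <= K -> 0 < g -> 0 <= S -> 0 < a -> a <= a0 ->
  a <= rho * a' -> 0 <= e -> e <= g * a -> 0 <= d -> d <= eta * a ^+ 2 ->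
  rho * (n * (K * g ^+ 2 + eta) + S * (K * g + eta * a0 + 2)) <= g ->
  n * (K * e ^+ 2 + d) / a + S * (K * e + d + 2 * a) <= g * a'.
Proof.
move=> rho0 n0 K0 g0 S0 apos aa0 aa' e0 ega d0 da gain.
have eta0 : 0 <= eta by have := le_trans d0 da; rewrite pmulr_lge0// exprn_gt0.
have e2 : e ^+ 2 <= g ^+ 2 * a ^+ 2.
  by rewrite -exprMn ler_pXn2r ?nnegrE// mulr_ge0 ?ltW.
have t1 : n * (K * e ^+ 2 + d) / a <= a * (n * (K * g ^+ 2 + eta)).
  rewrite ler_pdivrMr//.
  have -> : a * (n * (K * g ^+ 2 + eta)) * a =
    n * (K * (g ^+ 2 * a ^+ 2) + eta * a ^+ 2) by ring.
  by rewrite ler_pM2l// lerD// ler_wpM2l.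
have t2 : S * (K * e + d + 2 * a) <= a * (S * (K * g + eta * a0 + 2)).
  rewrite [leRHS]mulrCA ler_wpM2l//.
  have de : d <= a * (eta * a0).
    apply: le_trans da _; rewrite expr2 mulrA [leRHS]mulrC ler_pM2r//.
    by rewrite ler_wpM2l.
  have Ke : K * e <= a * (K * g) by rewrite [leRHS]mulrCA [a * g]mulrC ler_wpM2l.
  lra.
apply: le_trans (lerD t1 t2) _; rewrite -mulrDr.
rewrite -(ler_pM2l rho0) mulrCA.
apply: (@le_trans _ _ (a * g)); first by rewrite ler_wpM2l// ltW.
by rewrite mulrC mulrCA ler_wpM2l// ltW.
Qed.

Lemma ler_sqrtD (R : rcfType) (a b : R) : 0 <= a -> 0 <= b ->
  Num.sqrt (a + b) <= Num.sqrt a + Num.sqrt b.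
Proof.
move=> a0 b0; rewrite -(@ler_pXn2r _ 2)// ?nnegrE ?addr_ge0 ?sqrtr_ge0//.
rewrite sqrrD !sqr_sqrtr ?addr_ge0// [leRHS]addrAC lerDl.
by rewrite mulrn_wge0// mulr_ge0 ?sqrtr_ge0.
Qed.

Theorem corollary1 (R : realType) (X : completeNormedModType R)
    (J : X -> {linear X -> R^o}) (N : nat)
    (F : 'I_N -> X -> X) (f : 'I_N -> X) (xs : X) (r K rho : R)
    (alpha : nat -> R) :
  single_valued_duality_map J ->
  (1 <= N)%N ->
  (forall i, accretive J (F i)) ->
  (forall i, F i xs = f i) ->
  0 < r ->
  (forall i, frechet_on (closed_ball xs r) (F i)) ->
  (forall i, lipschitz_derivative_on (closed_ball xs r) K (F i)) ->
  (forall n, 0 < alpha n) ->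
  alpha @ \oo --> (0 : R) ->
  1 < rho ->
  (forall n, 1 <= alpha n / alpha n.+1 <= rho) ->
  exists2 eta0 : R, 0 < eta0 &
  forall eta : R, 0 < eta -> eta <= eta0 ->
  exists eps_v eps_x : R, [/\ 0 < eps_v, 0 < eps_x &
  forall (v xi0 : 'I_N -> X) (x0 : X),
  (forall i, closed_ball xs r (xi0 i)) ->
  (forall i, xi0 i - xs = 'd (F i) xs (v i)) ->
  closed_ball xs r x0 ->
  \sum_(i < N) `|v i| <= eps_v ->
  `|x0 - xs| <= eps_x ->
  exists C : R,
  forall (delta h : R) (fd : 'I_N -> X) (Fh : 'I_N -> X -> X)
    (x : nat -> X) (xi : nat -> 'I_N -> X),
  0 < delta -> 0 < h ->
  (delta + h) / eta <= alpha 0%N ^+ 2 ->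
  (forall i, accretive J (Fh i)) ->
  (forall i, frechet_on (closed_ball xs r) (Fh i)) ->
  (forall i, `|fd i - f i| <= delta) ->
  (forall i, lipschitz_derivative_on (closed_ball xs r) K (Fh i)) ->
  (forall i, `|Fh i xs - F i xs| <= h) ->
  (forall i, opnorm ('d (Fh i) xs \- 'd (F i) xs : X -> X) <= h) ->
  x 0%N = x0 ->
  (forall n, (n <= stop_index alpha eta delta h)%N ->
     parallel_step Fh fd xi0 (alpha n) (x n) (xi n) (x n.+1)) ->
  `|x (stop_index alpha eta delta h).+1 - xs|
    <= C * (Num.sqrt delta + Num.sqrt h)].
Proof.
move=> Jsv N1 _ Fxs r0 Fd _ apos acvg rho1 aratio.
have rho0 : 0 < rho by lra.
have N0 : 0 < N%:R :> R by rewrite ltr0n.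
have adecS n : alpha n.+1 <= alpha n.
  by have /andP[+ _] := aratio n; rewrite ler_pdivlMr// mul1r.
have arho n : alpha n <= rho * alpha n.+1.
  by have /andP[_] := aratio n; rewrite ler_pdivrMr.
have adec : {homo alpha : m n / (m <= n)%N >-> n <= m}.
  exact/nonincreasing_seqP.
(* [K] may be negative; a positive Lipschitz constant avoids that case and
   lets [g] be defined by a quotient. *)
pose L := `|K| + 1.
have L0 : 0 < L by rewrite ltr_wpDl.
have KL : K <= L by apply: le_trans (ler_norm _) _; rewrite lerDl.
(* The first argument of the minimum keeps the iterates in the ball, the
   second one makes the quadratic term at most a quarter of [g]. *)
pose g := Num.min (r / alpha 0%N) (4 * rho * N%:R * L)^-1.
have g0 : 0 < g by rewrite lt_min divr_gt0//= invr_gt0 !mulr_gt0.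
have gr : g * alpha 0%N <= r by rewrite -ler_pdivlMr// ge_min lexx.
have gL : rho * (N%:R * (L * g ^+ 2)) <= g / 4.
  have : g <= (4 * rho * N%:R * L)^-1 by rewrite ge_min lexx orbT.
  rewrite -[_^-1]mul1r ler_pdivlMr ?mulr_gt0// => ?.
  have -> : rho * (N%:R * (L * g ^+ 2)) = (g * (4 * rho * N%:R * L)) * (g / 4).
    by field.
  by rewrite ler_piMl// ltW// divr_gt0.
exists (g / (4 * rho * N%:R)); first by rewrite divr_gt0 ?mulr_gt0.
move=> eta eta_gt0; rewrite ler_pdivlMr ?mulr_gt0// => eta_le.
pose c := L * g + eta * alpha 0%N + 2.
have c0 : 0 < c by rewrite !addr_gt0 ?mulr_gt0.
exists (g / (2 * rho * c)), (g * alpha 0%N); split.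
- by rewrite divr_gt0 ?mulr_gt0.
- by rewrite mulr_gt0.
move=> v xi0 x0 _ xi0E _; set S := \sum_i _ => S_le x0_le.
have S0 : 0 <= S by exact: sumr_ge0.
have vS i : `|v i| <= S by rewrite /S (bigD1 i)//= lerDl sumr_ge0.
(* The three terms add up to at most [g / 4 + g / 4 + g / 2]. *)
have gain : rho * (N%:R * (L * g ^+ 2 + eta) + S * c) <= g.
  move: S_le; rewrite ler_pdivlMr ?mulr_gt0// => S_le.
  lra.
exists (g / Num.sqrt eta).
move=> delta h fd Fh x xi delta0 h0 noise Fhacc Fhd fdE FhK FhE FhdE xx0 steps.
have FhL i : lipschitz_derivative_on (closed_ball xs r) L (Fh i).
  move=> y z By Bz; apply: le_trans (FhK i y z By Bz) _.
  by rewrite ler_wpM2r.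
have dh0 : 0 < delta + h by rewrite addr_gt0.
have [noise_le noise_gt] :=
  stop_indexP apos adec acvg (divr_gt0 dh0 eta_gt0) noise.
set s := stop_index _ _ _ _ in steps noise_le noise_gt *.
have Bs : closed_ball xs r xs.
  by rewrite closed_ballE//= /closed_ball_/= subrr normr0 ltW.
have data i : `|fd i - Fh i xs| <= delta + h.
  rewrite -(subrKA (f i)); apply: le_trans (ler_normD _ _) _.
  by rewrite lerD// distrC -Fxs.
have source i : `|xi0 i - xs - 'd (Fh i) xs (v i)| <= (delta + h) * `|v i|.
  rewrite xi0E distrC.
  have dc : continuous ('d (Fh i) xs \- 'd (F i) xs : X -> X).
    by move=> p; apply: continuousB; apply: diff_continuous; [exact: Fhd|exact: Fd].
  have := @le_opnorm _ _ _ ('d (Fh i) xs \- 'd (F i) xs : {linear X -> X}) (v i) dc.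
  move/le_trans; apply; rewrite ler_wpM2r//.
  by apply: le_trans (FhdE i) _; rewrite lerDr ltW.
have inv n : (n <= s.+1)%N -> `|x n - xs| <= g * alpha n.
  elim: n => [_|n IHn ns]; first by rewrite xx0.
  have en := IHn (ltnW ns).
  have Bx : closed_ball xs r (x n).
    rewrite closed_ballE//= /closed_ball_/= distrC; apply: le_trans en _.
    by apply: le_trans gr; rewrite ler_pM2l// adec.
  have := parallel_step_le Jsv N1 Fhacc r0 (ltW L0) Fhd FhL Bx (apos n) (ltW dh0)
    data source vS (steps n ns).
  move/le_trans; apply.
  apply: (@step_gain_le _ _ _ _ eta _ (alpha 0%N) _ _ rho) => //; try exact: ltW.
    exact: adec.
  by rewrite mulrC -ler_pdivrMr// noise_le.
apply: le_trans (inv _ (leqnn _)) _; rewrite -mulrA ler_pM2l//.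
rewrite -[alpha _]ger0_norm ?(ltW (apos _))// -sqrtr_sqr.
apply: le_trans (ler_wsqrtr (ltW noise_gt)) _.
rewrite sqrtrM ?(ltW dh0)// sqrtrV ?(ltW eta_gt0)// [leLHS]mulrC.
rewrite ler_pM2l ?invr_gt0 ?sqrtr_gt0//.
by rewrite ler_sqrtD// ltW.
Qed.
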